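(* Let $I\subset\mathbb{R}$ be an interval, let $f:I\to\mathbb{R}$ be a function, let $\Phi:\mathcal{M}_m\to\mathcal{M}_n$ be a unital positive linear map, and let $A\in\mathcal{M}_m$ be a Hermitian matrix with spectrum contained in $I$. (i) If $f$ is convex, then $\lambda^\downarrow(f(\Phi(A)))\prec_w\lambda^\downarrow(\Phi(f(A)))$. If $f$ is concave, then $\lambda^\downarrow(f(\Phi(A)))\prec^w\lambda^\downarrow(\Phi(f(A)))$. (ii) If $f$ is convex and monotone, then $\lambda^\downarrow(f(\Phi(A)))\le\lambda^\downarrow(\Phi(f(A)))$ entrywise. If $f$ is concave and monotone, then $\lambda^\downarrow(f(\Phi(A)))\ge\lambda^\downarrow(\Phi(f(A)))$ entrywise.
   Context: $\mathcal{M}_n$ is the set of $n\times n$ complex matrices. A linear map $\Phi:\mathcal{M}_m\to\mathcal{M}_n$ is positive if it maps (strictly) positive definite matrices to (strictly) positive definite matrices, and unital if $\Phi(I_m)=I_n$, where $I_m, I_n$ are identity matrices. For Hermitian $H$ with spectrum in the domain of $f$, $f(H)$ is defined by the spectral functional calculus. $\lambda^\downarrow(H)$ is the vector of eigenvalues of $H$ (with multiplicity) in decreasing order. For $x,y\in\mathbb{R}^n$, let $x^\downarrow$ and $x^\uparrow$ denote the rearrangements of $x$ in decreasing and increasing order. The weak majorization $x\prec_w y$ means $\sum_{j=1}^k x_j^\downarrow\le\sum_{j=1}^k y_j^\downarrow$ for all $1\le k\le n$. The weak supermajorization $x\prec^w y$ means $\sum_{j=1}^k x_j^\uparrow\ge\sum_{j=1}^k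 y_j^\uparrow$ for all $1\le k\le n$. Monotone means either nondecreasing or nonincreasing. *)

(* Defs.v *)
(* The field of complex numbers is R[i] for R : realType. *)
From HB Require Import structures.
From mathcomp Require Import all_boot all_order all_algebra.
From mathcomp Require Import sesquilinear spectral complex.
From mathcomp Require Import boolp classical_sets reals interval_inference topology normedtype convex.

Set Implicit Arguments.
Unset Strict Implicit.
Unset Printing Implicit Defensive.

Import Order.TTheory GRing.Theory Num.Theory.
Import numFieldNormedType.Exports.

Local Open Scope classical_set_scope.
Local Open Scope ring_scope.
Local Open Scope complex_scope.
Local Open Scope convex_scope.
Local Open Scope sesquilinear_scope.

(* In a numClosedFieldType, 0 < z means that z is real and positive. *)
Definition posdefmx (C : numClosedFieldType) n (A : 'M[C]_n) : Prop :=
  A \is hermsymmx /\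
  forall x : 'cV[C]_n, x != 0 -> 0 < (x^t* *m A *m x) 0 0.

Definition positive_map (C : numClosedFieldType) m n
    (Phi : {linear 'M[C]_m -> 'M[C]_n}) : Prop :=
  forall A : 'M[C]_m, posdefmx A -> posdefmx (Phi A).

Definition unital_map (C : numClosedFieldType) m n
    (Phi : {linear 'M[C]_m -> 'M[C]_n}) : Prop := Phi 1%:M = 1%:M.

Definition spectrum (C : fieldType) n (A : 'M[C]_n) : set C :=
  [set z | eigenvalue A z].

Section Hermitian.
Variable R : realType.

(* The spectral diagonal of a Hermitian matrix is real; eigvals H and
   herm_fun f H are meaningful only for Hermitian H. *)
Definition eigvals n (H : 'M[R[i]]_n) : 'rV[R]_n :=
  map_mx (@complex.Re R) (spectral_diag H).

Definition herm_fun (f : R -> R) n (H : 'M[R[i]]_n) : 'M[R[i]]_n :=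
  invmx (spectralmx H) *m diag_mx (map_mx (fun t => (f t)%:C) (eigvals H))
    *m spectralmx H.

Definition sort_decr n (x : 'rV[R]_n) : 'rV[R]_n :=
  \row_i (sort >=%R [seq x 0 j | j <- enum 'I_n])`_i.

Definition sort_incr n (x : 'rV[R]_n) : 'rV[R]_n :=
  \row_i (sort <=%R [seq x 0 j | j <- enum 'I_n])`_i.

Definition eigvals_decr n (H : 'M[R[i]]_n) : 'rV[R]_n := sort_decr (eigvals H).

(* Indices start at 0: the first k entries are those with index j < k. *)
Definition weak_majorized n (x y : 'rV[R]_n) : Prop :=
  forall k : nat, (1 <= k <= n)%N ->
    \sum_(j < n | (j < k)%N) sort_decr x 0 j <= \sum_(j < n | (j < k)%N) sort_decr y 0 j.

Definition weak_supermajorized n (x y : 'rV[R]_n) : Prop :=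
  forall k : nat, (1 <= k <= n)%N ->
    \sum_(j < n | (j < k)%N) sort_incr x 0 j >= \sum_(j < n | (j < k)%N) sort_incr y 0 j.

Definition concave_function (I : set R^o) (f : R^o -> R^o) : Prop :=
  forall t : {i01 R},
    {in I &, forall x y : R^o, f x <| t |> f y <= f (x <| t |> y)}.

Definition monotone_on (I : set R) (f : R -> R) : Prop :=
  {in I &, {homo f : x y / x <= y}} \/ {in I &, {homo f : x y /~ x <= y}}.

Lemma map_eigvals n (H : 'M[R[i]]_n) : H \is hermsymmx ->
  map_mx (fun t => t%:C) (eigvals H) = spectral_diag H.
Proof.
move=> /hermitian_spectral_diag_real/mxOverP sR; apply/rowP => j.
by rewrite !mxE RRe_real.
Qed.

(* eigvals lists the eigenvalues with their multiplicities. *)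
Lemma char_poly_eigvals n (H : 'M[R[i]]_n) : H \is hermsymmx ->
  char_poly H = \prod_(j < n) ('X - ((eigvals H 0 j)%:C)%:P).
Proof.
move=> hH.
have /orthomx_spectralP HE := hermitian_normalmx hH.
have Pu := spectral_unit H.
have -> : char_poly H = char_poly (diag_mx (spectral_diag H)).
  rewrite /char_poly /char_poly_mx [in LHS]HE !map_mxM/= map_invmx.
  have Pu' : map_mx polyC (spectralmx H) \in unitmx by rewrite map_unitmx.
  set P := map_mx _ _ in Pu' *.
  have PX : invmx P *m 'X%:M *m P = 'X%:M.
    by rewrite mul_mx_scalar -scalemxAl mulVmx// scalemx1.
  by rewrite -[in LHS]PX -mulmxBl -mulmxBr !det_mulmx mulrC mulrA -det_mulmx mulmxV// det1 mul1r.
rewrite char_poly_trig ?diag_mx_is_trig//.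
apply: eq_bigr => j _; rewrite -(map_eigvals hH) !mxE eqxx mulr1n.
by [].
Qed.

(* herm_fun does not depend on the chosen diagonalization. *)
Lemma herm_funE f n (U : 'M[R[i]]_n) (d : 'rV[R]_n) (H : 'M[R[i]]_n) :
  H \is hermsymmx -> U \in unitmx ->
  H = invmx U *m diag_mx (map_mx (fun t => t%:C) d) *m U ->
  herm_fun f H = invmx U *m diag_mx (map_mx (fun t => (f t)%:C) d) *m U.
Proof.
move=> hH Uu HU.
have /orthomx_spectralP := hermitian_normalmx hH.
rewrite -(map_eigvals hH) /herm_fun; move: (spectral_unit H).
move: (spectralmx H) (eigvals H) => P e Pu HP.
pose W := P *m invmx U.
have key : diag_mx (map_mx (fun t => t%:C) e) *m W =
           W *m diag_mx (map_mx (fun t => t%:C) d).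
  have := HU; rewrite HP => /(congr1 (fun X => P *m X *m invmx U)).
  by rewrite !mulmxA mulmxV// mul1mx mulmxK// /W !mulmxA.
suff key2 : diag_mx (map_mx (fun t => (f t)%:C) e) *m W =
           W *m diag_mx (map_mx (fun t => (f t)%:C) d).
  have PE : P = W *m U by rewrite /W mulmxKV.
  have PVE : invmx U = invmx P *m W by rewrite mulKmx.
  rewrite PVE -(mulmxA _ W) -key2.
  by rewrite -[RHS]mulmxA -[X in _ = _ *m X]mulmxA -PE mulmxA.
apply/matrixP => i j; have /matrixP/(_ i j) := key.
rewrite !mul_diag_mx !mul_mx_diag !mxE; move: (\sum_ _ _) => w.
rewrite ![w * _]mulrC => /eqP; rewrite -subr_eq0 -mulrBl mulf_eq0 => /orP[|/eqP->].
  by rewrite subr_eq0 => /eqP/complexI->.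
by rewrite !mulr0.
Qed.

End Hermitian.

(* Main.v *)
(** Let [P_i] be the eigenprojections of [A] and [a_i] its eigenvalues.  For a
    nonzero vector [x], the numbers [x Phi(P_i) x^* / |x|^2] are nonnegative
    weights summing to 1, so Jensen's inequality gives
    [f (x Phi(A) x^* / |x|^2) <= x Phi(f(A)) x^* / |x|^2] for convex [f].
    For (i), apply it to an eigenbasis of [Phi(A)]: the eigenvalues of
    [f(Phi(A))] are bounded by the diagonal of [Phi(f(A))] in that basis, which
    is the image of the eigenvalues of [Phi(f(A))] under a doubly stochastic
    matrix.  For (ii), if [f(Phi(A))] had more eigenvalues [>= c] than
    [Phi(f(A))], some nonzero [x] would lie both in the span of the
    eigenvectors of [Phi(A)] with [f(b_j) >= c] and in that of the eigenvectors
    of [Phi(f(A))] with eigenvalue [< c]; as a monotone [f] is quasi-concave,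
    this contradicts the inequality.  The concave cases follow by applying the
    convex ones to [-f]. *)
Require Import Defs.
From HB Require Import structures.
From mathcomp Require Import all_boot all_order all_algebra all_fingroup.
From mathcomp Require Import sesquilinear spectral complex ring lra zify.
From mathcomp Require Import boolp classical_sets reals interval_inference topology normedtype convex.

Set Implicit Arguments.
Unset Strict Implicit.
Unset Printing Implicit Defensive.

Import Order.TTheory GRing.Theory Num.Theory.
Import numFieldNormedType.Exports.

Local Open Scope ring_scope.
Local Open Scope complex_scope.
Local Open Scope sesquilinear_scope.

(** * Convex combinations and scalar Jensen inequality *)

Lemma convex_comb_closed (R : realFieldType) (V : lmodType R) (P : V -> Prop)
    (J : finType) (w : J -> R) (v : J -> V) :
  (forall x y t, 0 <= t <= 1 -> P x -> P y -> P (t *: x + (1 - t) *: y)) ->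
  (forall j, 0 <= w j) -> \sum_j w j = 1 -> (forall j, w j != 0 -> P (v j)) ->
  P (\sum_j w j *: v j).
Proof.
move=> Pconv w0 w1 Pv.
(* Partial sums are normalized by their total weight, so that each induction step is a binary convex
   combination. *)
suff key r : 0 < \sum_(j <- r) w j ->
    P ((\sum_(j <- r) w j)^-1 *: \sum_(j <- r) w j *: v j).
  have := key (index_enum J); rewrite w1 invr1 scale1r; apply; exact: ltr01.
elim: r => [|i r IH]; first by rewrite big_nil ltxx.
rewrite !big_cons; have [->|wi] := eqVneq (w i) 0; first by rewrite add0r scale0r add0r.
have wi0 : 0 < w i by rewrite lt_def wi w0.
set s := \sum_(j <- r) w j in IH *.
have s0 : 0 <= s by apply: sumr_ge0.
move=> ws0; have [sE|sN] := eqVneq s 0.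
  have -> : \sum_(j <- r) w j *: v j = 0.
    rewrite big_seq big1// => j jr.
    have : all (fun j => true ==> (w j == 0)) r.
      by rewrite -psumr_eq0 ?sE//; apply/eqP; rewrite -[RHS]sE.
    by move=> /allP/(_ _ jr)/= /eqP->; rewrite scale0r.
  by rewrite sE !addr0 scalerA mulVf// scale1r; apply: Pv.
have s_gt0 : 0 < s by rewrite lt_def sN.
have wsN : w i + s != 0 by rewrite gt_eqF.
have := Pconv (v i) _ (w i / (w i + s)) _ (Pv _ wi) (IH s_gt0).
rewrite scalerDr !scalerA.
have -> : (1 - w i / (w i + s)) / s = (w i + s)^-1 by field; rewrite wsN.
rewrite ![(_ + _)^-1 * w i]mulrC; apply.
by rewrite divr_ge0// ?(ltW ws0)//= ler_pdivrMr// mul1r lerDl.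
Qed.

Section ScalarConvexity.
Variables (R : realType) (I : set R) (f : R -> R).
Hypothesis I_itv : is_interval I.

Lemma is_interval_conv x y t : 0 <= t <= 1 -> I x -> I y ->
  I (t * x + (1 - t) * y).
Proof.
move=> t01 Ix Iy; have [xy|/ltW yx] := leP x y.
  by apply: I_itv Ix Iy _ _; apply/andP; split; nra.
by apply: I_itv Iy Ix _ _; apply/andP; split; nra.
Qed.

Lemma convex_function_ineq x y t : convex_function (I : set R^o) f ->
  0 <= t <= 1 -> I x -> I y ->
  f (t * x + (1 - t) * y) <= t * f x + (1 - t) * f y.
Proof.
move=> cf /andP[t0 t1] Ix Iy.
have ti : Itv.spec (Itv.num_sem (R:=R)) (Itv.Real `[0%Z, 1%Z]) t.
  by rewrite /= /Itv.num_sem /= num_real in_itv/= t0 t1.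
by have := cf (Itv.mk ti) x y (mem_set Ix) (mem_set Iy).
Qed.

(** The epigraph of [f] over [I] is convex, so it contains the barycentre of the points
    [(a j, f (a j))]. *)
Lemma jensen (J : finType) (w a : J -> R) : convex_function (I : set R^o) f ->
  (forall j, 0 <= w j) -> \sum_j w j = 1 -> (forall j, w j != 0 -> I (a j)) ->
  I (\sum_j w j * a j) /\ f (\sum_j w j * a j) <= \sum_j w j * f (a j).
Proof.
move=> cf w0 w1 Ia.
pose P (p : R^o * R^o) := I p.1 /\ f p.1 <= p.2.
have := @convex_comb_closed R (R^o * R^o)%type P J w (fun j => (a j, f (a j))).
have -> : \sum_j w j *: ((a j, f (a j)) : (R^o * R^o)%type) =
    (\sum_j w j * a j, \sum_j w j * f (a j)).
  by elim/big_rec3: _ => // j x y z _ ->.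
apply=> //; last by move=> j wj; split => //=; apply: Ia.
move=> [x1 x2] [y1 y2] t t01 [/= Ix fx] [/= Iy fy]; split=> /=.
  exact: is_interval_conv.
apply: (@le_trans _ _ (t * f x1 + (1 - t) * f y1)); first exact: convex_function_ineq.
move/andP: t01 => [t0 t1].
by apply: lerD; apply: ler_wpM2l => //; rewrite subr_ge0.
Qed.

(** On a segment a monotone function is at least the smaller of its two endpoint values, so its
    superlevel sets are convex. *)
Lemma monotone_superlevel (J : finType) (w a : J -> R) c : monotone_on I f ->
  (forall j, 0 <= w j) -> \sum_j w j = 1 ->
  (forall j, w j != 0 -> I (a j) /\ c <= f (a j)) ->
  c <= f (\sum_j w j * a j).
Proof.
move=> mf w0 w1 Ha.
pose P (z : R^o) := I z /\ c <= f z.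
suff [] : P (\sum_j w j *: (a j : R^o)) by [].
apply: convex_comb_closed => // x y t t01 [Ix fx] [Iy fy].
have Iz := is_interval_conv t01 Ix Iy.
split=> //=; change (c <= f (t * x + (1 - t) * y)).
case: mf => mf; have [xy|/ltW yx] := leP x y.
- by apply: (le_trans fx); apply: mf; rewrite ?inE//; nra.
- by apply: (le_trans fy); apply: mf; rewrite ?inE//; nra.
- by apply: (le_trans fy); apply: mf; rewrite ?inE//; nra.
- by apply: (le_trans fx); apply: mf; rewrite ?inE//; nra.
Qed.

End ScalarConvexity.

(** * Sorted vectors and weak majorization *)

Section Sorting.
Variable R : realType.
Implicit Types n : nat.

Lemma sort_decr_perm n (x : 'rV[R]_n) :
  exists s : 'S_n, forall j, sort_decr x 0 j = x 0 (s j).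
Proof.
have : perm_eq (sort >=%R [seq x 0 j | j <- enum 'I_n]) [tuple x 0 j | j < n].
  by rewrite perm_sort.
move=> /tuple_permP[s sE]; exists s => j; rewrite mxE sE.
rewrite -(tnth_nth 0 [tuple tnth [tuple x 0 k | k < n] (s i) | i < n] j).
by rewrite !tnth_mktuple.
Qed.

Lemma size_row_seq n (x : 'rV[R]_n) : size [seq x 0 j | j <- enum 'I_n] = n.
Proof. by rewrite size_map -cardE card_ord. Qed.

Lemma sort_decr_homo n (x : 'rV[R]_n) (i j : 'I_n) : (i <= j)%N ->
  sort_decr x 0 j <= sort_decr x 0 i.
Proof.
move=> ij; rewrite !mxE.
have ge_trans : transitive (>=%R : rel R) by move=> a b c ba cb; exact: le_trans cb ba.
apply: (sorted_leq_nth (leT := >=%R)) => //.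
- by move=> a; exact: lexx.
- by apply: sort_sorted => a b; exact: le_total.
- by rewrite inE size_sort size_row_seq.
- by rewrite inE size_sort size_row_seq.
Qed.

Lemma sort_decr_eq n (x y : 'rV[R]_n) :
  perm_eq [seq x 0 j | j <- enum 'I_n] [seq y 0 j | j <- enum 'I_n] ->
  sort_decr x = sort_decr y.
Proof.
move=> xy; apply/rowP => j; rewrite !mxE; congr nth; apply/perm_sortP => //.
- by move=> a b; exact: le_total.
- by move=> a b c ba cb; exact: le_trans cb ba.
- by move=> a b /le_anti.
Qed.

(** Needed because the majorizations of the theorem sort vectors that [eigvals_decr] has already
    sorted. *)
Lemma sort_decr_id n (x : 'rV[R]_n) : sort_decr (sort_decr x) = sort_decr x.
Proof.
apply: sort_decr_eq; have [s sE] := sort_decr_perm x.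
apply/(@tuple_permP _ n _ [tuple x 0 j | j < n]); exists s.
by apply: eq_map => j /=; rewrite sE tnth_mktuple.
Qed.

Lemma sort_incr_rev n (x : 'rV[R]_n) j :
  sort_incr x 0 j = sort_decr x 0 (rev_ord j).
Proof.
rewrite !mxE.
have -> : sort <=%R [seq x 0 j | j <- enum 'I_n] =
    rev (sort >=%R [seq x 0 j | j <- enum 'I_n]).
  apply: (sorted_eq (leT := <=%R)).
  - exact: le_trans.
  - exact: le_anti.
  - by apply: sort_sorted; exact: le_total.
  - by rewrite rev_sorted; apply: sort_sorted => a b; exact: le_total.
  - by rewrite perm_sort perm_sym perm_rev perm_sort.
by rewrite nth_rev size_sort size_row_seq.
Qed.

Lemma sort_incrN n (x : 'rV[R]_n) j : sort_incr x 0 j = - sort_decr (- x) 0 j.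
Proof.
rewrite !mxE.
have -> : [seq (- x) 0 j | j <- enum 'I_n] = map -%R [seq x 0 j | j <- enum 'I_n].
  by rewrite -[RHS]map_comp; apply: eq_map => i; rewrite /= mxE.
rewrite [in RHS]sort_map (nth_map 0) ?size_sort ?size_row_seq// opprK; congr nth.
by congr (sort _ _); apply/funext => a; apply/funext => b; rewrite /= lerN2.
Qed.

Lemma weak_majorized_sort_decr n (x y : 'rV[R]_n) :
  weak_majorized (sort_decr x) (sort_decr y) <-> weak_majorized x y.
Proof. by rewrite /weak_majorized !sort_decr_id. Qed.

(** The smallest entries of [x] are the negatives of the largest entries of [- x]; this turns the
    concave case of (i) into a convex one. *)
Lemma weak_supermajorizedN n (x y : 'rV[R]_n) :
  weak_majorized (- x) (- y) -> weak_supermajorized (sort_decr x) (sort_decr y).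
Proof.
move=> xy k /xy.
have H (z : 'rV[R]_n) j : sort_incr (sort_decr z) 0 j = - sort_decr (- z) 0 j.
  by rewrite sort_incr_rev sort_decr_id -sort_incr_rev sort_incrN.
under [X in _ -> X <= _]eq_bigr do rewrite H.
under [X in _ -> _ <= X]eq_bigr do rewrite H.
by rewrite !sumrN lerN2.
Qed.

Lemma sort_decr_leN n (x y : 'rV[R]_n) :
  (forall j, sort_decr (- x) 0 j <= sort_decr (- y) 0 j) ->
  forall j, sort_decr y 0 j <= sort_decr x 0 j.
Proof.
(* Negation exchanges largest and smallest entries, hence the reversed index. *)
move=> xy j; have := xy (rev_ord j); rewrite -lerN2.
have H (z : 'rV[R]_n) : - sort_decr (- z) 0 (rev_ord j) = sort_decr z 0 j.
  by rewrite -sort_incrN sort_incr_rev rev_ordK.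
by rewrite !H.
Qed.

(** If the inequality failed at [j], take [sort_decr x 0 j] as threshold: at least [j.+1] entries of
    [x] reach it, since indices start at 0, but at most [j] entries of [y] do. *)
Lemma sort_decr_le_count n (x y : 'rV[R]_n) :
  (forall c, (#|[set j | (c <= x 0 j)%R]| <= #|[set j | (c <= y 0 j)%R]|)%N) ->
  forall j, sort_decr x 0 j <= sort_decr y 0 j.
Proof.
move=> xy j; rewrite leNgt; apply/negP => yx.
have [s sE] := sort_decr_perm x; have [t tE] := sort_decr_perm y.
set c := sort_decr x 0 j in yx.
have := xy c; apply/negP; rewrite -ltnNge.
have Hy : (#|[set j | (c <= y 0 j)%R]| <= j)%N.
  (* Moved to their sorted positions by [t^-1], the entries of [y] that reach [c] all lie before
     [j]. *)
  rewrite -(card_imset _ (@perm_inj _ (t^-1)%g)).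
  apply: (@leq_trans #|[set i : 'I_n | (i < j)%N]|).
    apply: subset_leq_card; apply/fintype.subsetP => i /imsetP[k].
    rewrite inE => ck ->; rewrite inE.
    rewrite ltnNge; apply/negP => jk; move: ck; rewrite -[k](permKV t) -tE; apply/negP.
    by rewrite -ltNge; apply: le_lt_trans yx; apply: sort_decr_homo.
  by rewrite cardsE -sum1_card (big_ord_narrow (ltnW (ltn_ord j))) sum1_card card_ord.
have Hx : (j < #|[set j | (c <= x 0 j)%R]|)%N.
  have -> : j.+1 = #|[set i : 'I_n | (i < j.+1)%N]|.
    by rewrite cardsE -sum1_card (big_ord_narrow (ltn_ord j)) sum1_card card_ord.
  rewrite -(card_imset _ (@perm_inj _ s)).
  apply: subset_leq_card; apply/fintype.subsetP => i /imsetP[k].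
  rewrite inE ltnS => ck ->; rewrite inE.
  by rewrite -sE; apply: sort_decr_homo.
exact: leq_ltn_trans Hx.
Qed.

(* Ky Fan: with threshold the k-th largest entry [tau], each term
   [c_j (y_j - tau)] is at most [y_j - tau] on the top k indices and at most 0
   on the others. *)
Lemma weighted_sum_le_top n (y c : 'rV[R]_n) k : (1 <= k <= n)%N ->
  (forall j, 0 <= c 0 j <= 1) -> \sum_j c 0 j = k%:R ->
  \sum_j c 0 j * y 0 j <= \sum_(j < n | (j < k)%N) sort_decr y 0 j.
Proof.
move=> /andP[k0 kn] c01 ck; have [s sE] := sort_decr_perm y.
have kn' : (k.-1 < n)%N by rewrite prednK.
pose tau := sort_decr y 0 (Ordinal kn').
have cardk : \sum_(j < n | (j < k)%N) tau = k%:R * tau.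
  by rewrite (big_ord_narrow kn) sumr_const card_ord mulr_natl.
have : \sum_j c 0 (s j) * (sort_decr y 0 j - tau) <=
    \sum_(j < n | (j < k)%N) (sort_decr y 0 j - tau).
  rewrite [leRHS]big_mkcond; apply: ler_sum => j _.
  have /andP[c0 c1] := c01 (s j); case: ifPn => jk.
    rewrite ler_piMl// subr_ge0; apply: sort_decr_homo.
    by rewrite /= -ltnS prednK.
  rewrite mulr_ge0_le0// subr_le0; apply: sort_decr_homo.
  by rewrite -leqNgt in jk; exact: leq_trans (leq_pred k) jk.
rewrite sumrB cardk; under eq_bigr do rewrite mulrBr sE.
rewrite sumrB -mulr_suml.
rewrite -(reindex_inj (@perm_inj _ s) (P := xpredT) (F := fun j => c 0 j * y 0 j)).
rewrite -(reindex_inj (@perm_inj _ s) (P := xpredT) (F := fun j => c 0 j)) ck /=.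
by rewrite lerD2r.
Qed.

(** In the bound for the [k] largest entries of [x], the coefficient of [y 0 j] is a partial column
    sum, hence at most 1, and by the row sums the coefficients add up to [k]. Ky Fan's bound then
    applies. *)
Lemma weak_majorized_doubly_stochastic n (x y : 'rV[R]_n) (D : 'M[R]_n) :
  (forall i j, 0 <= D i j) -> (forall i, \sum_j D i j = 1) ->
  (forall j, \sum_i D i j = 1) -> (forall i, x 0 i <= \sum_j D i j * y 0 j) ->
  weak_majorized x y.
Proof.
move=> D0 Dr Dc xDy k /[dup] hk /andP[k0 kn]; have [s sE] := sort_decr_perm x.
pose c := \row_j \sum_(i < n | (i < k)%N) D (s i) j.
apply: (@le_trans _ _ (\sum_j c 0 j * y 0 j)).
  under [leRHS]eq_bigr do rewrite mxE mulr_suml.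
  rewrite exchange_big/=; apply: ler_sum => i _; rewrite sE; exact: xDy.
apply: weighted_sum_le_top => //.
- move=> j; rewrite mxE sumr_ge0//=.
  rewrite -(Dc j) [leRHS](reindex_inj (@perm_inj _ s)) big_mkcond/=.
  by apply: ler_sum => i _; case: ifP.
- under eq_bigr do rewrite mxE.
  rewrite exchange_big/=; under eq_bigr do rewrite Dr.
  by rewrite (big_ord_narrow kn) sumr_const card_ord.
Qed.

End Sorting.

(** * Quadratic forms and unitary diagonalization *)

Section QuadraticForms.
Variable R : realType.
Implicit Types n m : nat.

(** The squared modulus, valued in [R] so that the weights built from it are real. *)
Definition sqnormc (z : R[i]) : R := complex.Re z ^+ 2 + complex.Im z ^+ 2.

Lemma sqnormc_ge0 z : 0 <= sqnormc z.
Proof. by rewrite addr_ge0 ?sqr_ge0. Qed.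

Lemma mul_conjC_sqnormc (z : R[i]) : z * Num.conj z = (sqnormc z)%:C.
Proof.
by case: z => a b; apply/eqP; rewrite eq_complex /=; apply/andP; split;
  apply/eqP; rewrite /sqnormc/=; ring.
Qed.

Lemma sqnormc_eq0 z : (sqnormc z == 0) = (z == 0).
Proof.
by case: z => a b; rewrite eq_complex/= paddr_eq0 ?sqr_ge0// !sqrf_eq0.
Qed.

(** Vectors are rows here, matching the rows of [spectralmx], while [posdefmx] uses columns;
    conjugate transposition passes between the two. *)
Definition qform n (B : 'M[R[i]]_n) (x : 'rV[R[i]]_n) : R[i] :=
  (x *m B *m x^t*) 0 0.

Definition sqnorm n (x : 'rV[R[i]]_n) : R := \sum_j sqnormc (x 0 j).

(* The coordinate [(x *m V^t* ) 0 j] is the inner product of [x] with the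
   [j]-th row of [V]. *)
Definition coord_weight n (V : 'M[R[i]]_n) (x : 'rV[R[i]]_n) j : R :=
  sqnormc ((x *m V^t*) 0 j).

(** With the adjoint in place of the inverse, the matrix is Hermitian for every [V]. For unitary [V]
    the rows of [V] are eigenvectors. *)
Definition udiag n (V : 'M[R[i]]_n) (d : 'rV[R]_n) : 'M[R[i]]_n :=
  V^t* *m diag_mx (map_mx (fun t => t%:C) d) *m V.

Lemma udiagD n (V : 'M[R[i]]_n) d e : udiag V (d + e) = udiag V d + udiag V e.
Proof. by rewrite /udiag map_mxD raddfD/= mulmxDr mulmxDl. Qed.

Lemma udiagZ n (V : 'M[R[i]]_n) (c : R) d : udiag V (c *: d) = c%:C *: udiag V d.
Proof. by rewrite /udiag map_mxZ linearZ/= -scalemxAr -scalemxAl. Qed.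

Lemma udiagN n (V : 'M[R[i]]_n) d : udiag V (- d) = - udiag V d.
Proof. by rewrite -scaleN1r udiagZ rmorphN1 scaleN1r. Qed.

Lemma udiag_const n (V : 'M[R[i]]_n) (c : R) : V \is unitarymx ->
  udiag V (const_mx c) = (c%:C)%:M.
Proof.
move=> /unitarymxP/mulmx1C VV; rewrite /udiag map_const_mx diag_const_mx.
by rewrite mul_mx_scalar -scalemxAl VV scalemx1.
Qed.

Lemma adjmxK n p (B : 'M[R[i]]_(n, p)) : (B^t*)^t* = B.
Proof. by apply/matrixP => i j; rewrite !mxE conjCK. Qed.

Lemma adjmx_hermsymm n (B : 'M[R[i]]_n) : B^t* = B -> B \is hermsymmx.
Proof. by move=> BE; apply/is_hermitianmxP; rewrite expr0 scale1r BE. Qed.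

Lemma hermsymm_adjmx n (B : 'M[R[i]]_n) : B \is hermsymmx -> B^t* = B.
Proof. by move=> /is_hermitianmxP; rewrite expr0 scale1r => <-. Qed.

Lemma udiag_hermsymm n (V : 'M[R[i]]_n) d : udiag V d \is hermsymmx.
Proof.
apply: adjmx_hermsymm; rewrite /udiag !trmx_mul !map_mxM/= adjmxK mulmxA.
rewrite tr_diag_mx map_diag_mx.
suff -> : map_mx Num.conj (map_mx (fun t => t%:C) d) = map_mx (fun t => t%:C) d by [].
apply/rowP => j; rewrite !mxE; apply: (@conj_Creal R[i]).
by apply/complex_realP; exists (d 0 j).
Qed.

Lemma qform_udiag n (V : 'M[R[i]]_n) d x :
  qform (udiag V d) x = (\sum_j coord_weight V x j * d 0 j)%:C.
Proof.
rewrite /qform /udiag.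
have -> : x *m (V^t* *m diag_mx (map_mx (fun t => t%:C) d) *m V) *m x^t* =
    (x *m V^t*) *m diag_mx (map_mx (fun t => t%:C) d) *m (x *m V^t*)^t*.
  by rewrite trmx_mul map_mxM adjmxK !mulmxA.
rewrite /coord_weight; move: (x *m V^t*) => y.
rewrite mul_mx_diag mxE rmorph_sum; apply: eq_bigr => j _ /=.
by rewrite !mxE rmorphM/= -mul_conjC_sqnormc mulrAC.
Qed.

Lemma qform1 n (x : 'rV[R[i]]_n) : qform 1%:M x = (sqnorm x)%:C.
Proof.
rewrite /qform mulmx1 mxE rmorph_sum; apply: eq_bigr => j _.
by rewrite !mxE mul_conjC_sqnormc.
Qed.

Lemma qformD n (B C : 'M[R[i]]_n) x : qform (B + C) x = qform B x + qform C x.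
Proof. by rewrite /qform mulmxDr mulmxDl mxE. Qed.

Lemma qformZ n c (B : 'M[R[i]]_n) x : qform (c *: B) x = c * qform B x.
Proof. by rewrite /qform -scalemxAr -scalemxAl mxE. Qed.

Lemma coord_weight_ge0 n (V : 'M[R[i]]_n) x j : 0 <= coord_weight V x j.
Proof. exact: sqnormc_ge0. Qed.

(** Parseval's identity, obtained by writing the identity matrix as [udiag V (const_mx 1)]. *)
Lemma sum_coord_weight n (V : 'M[R[i]]_n) x : V \is unitarymx ->
  \sum_j coord_weight V x j = sqnorm x.
Proof.
move=> Vu; apply: (@complexI R); rewrite -(qform1 x).
have -> : qform 1%:M x = qform (udiag V (const_mx 1)) x by rewrite udiag_const.
rewrite qform_udiag.
by congr (_%:C); apply: eq_bigr => j _; rewrite mxE mulr1.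
Qed.

Lemma sqnorm_gt0 n (x : 'rV[R[i]]_n) : x != 0 -> 0 < sqnorm x.
Proof.
move=> x0; rewrite lt_def sumr_ge0 ?andbT; last by move=> j _; exact: sqnormc_ge0.
apply: contra x0; rewrite psumr_eq0; last by move=> j _; exact: sqnormc_ge0.
move=> /allP x0; apply/eqP/rowP => j; rewrite mxE; apply/eqP.
by have := x0 j (mem_index_enum _); rewrite -sqnormc_eq0.
Qed.

Lemma udiag_posdef n (V : 'M[R[i]]_n) (d : 'rV[R]_n) : V \is unitarymx ->
  (forall j, 0 < d 0 j) -> posdefmx (udiag V d).
Proof.
move=> Vu d0; split=> [|x x0]; first exact: udiag_hermsymm.
have xE : x = (x^t*)^t* by rewrite adjmxK.
have x0' : x^t* != 0.
  by apply: contra x0 => /eqP x0; rewrite xE x0 trmx0 map_mx0.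
rewrite [X in _ *m X]xE -/(qform _ _) qform_udiag ltcR.
(* The weights have a positive sum, so some weight is positive and contributes a strictly positive
   term. *)
have := sqnorm_gt0 x0'; rewrite -(sum_coord_weight _ Vu) => /lt0r_neq0.
rewrite psumr_neq0; last by move=> j _; exact: coord_weight_ge0.
move=> /hasP[j _ wj]; rewrite (bigD1 j)//= ltr_pwDl ?mulr_gt0//.
by apply: sumr_ge0 => k _; rewrite mulr_ge0 ?coord_weight_ge0// ltW.
Qed.

Lemma posdef_qform_gt0 n (B : 'M[R[i]]_n) (x : 'rV[R[i]]_n) :
  posdefmx B -> x != 0 -> 0 < qform B x.
Proof.
move=> [_ Bp] x0; have xE : x = (x^t*)^t* by rewrite adjmxK.
rewrite /qform {1}xE; apply: Bp; apply: contra x0 => /eqP x0.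
by rewrite xE x0 trmx0 map_mx0.
Qed.

Lemma hermsymm_udiagE n (H : 'M[R[i]]_n) : H \is hermsymmx ->
  H = udiag (spectralmx H) (eigvals H).
Proof.
move=> hH; rewrite /udiag map_eigvals// -invmx_unitary ?spectral_unitarymx//.
exact/orthomx_spectralP/hermitian_normalmx.
Qed.

Lemma herm_fun_udiag f n (H : 'M[R[i]]_n) :
  herm_fun f H = udiag (spectralmx H) (map_mx f (eigvals H)).
Proof.
rewrite /herm_fun (invmx_unitary (spectral_unitarymx H)) /udiag.
suff -> : map_mx (fun t => t%:C) (map_mx f (eigvals H)) =
  map_mx (fun t => (f t)%:C) (eigvals H) by [].
by apply/rowP => j; rewrite !mxE.
Qed.

Lemma coord_weight_row n (V W : 'M[R[i]]_n) i j :
  coord_weight W (row i V) j = sqnormc ((V *m W^t*) i j).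
Proof. by rewrite /coord_weight -row_mul mxE. Qed.

Lemma coord_weight_unitary n (V : 'M[R[i]]_n) i j : V \is unitarymx ->
  coord_weight V (row i V) j = (i == j)%:R.
Proof.
move=> /unitarymxP VV; rewrite coord_weight_row VV mxE /sqnormc.
by case: eqP => _ /=; rewrite ?expr0n ?expr1n ?addr0.
Qed.

Lemma sqnorm_row n (V : 'M[R[i]]_n) i : V \is unitarymx -> sqnorm (row i V) = 1.
Proof.
move=> Vu; rewrite -(sum_coord_weight _ Vu) (bigD1 i)//= coord_weight_unitary//.
rewrite eqxx big1 ?addr0// => j ji.
by rewrite coord_weight_unitary// eq_sym (negbTE ji).
Qed.

Lemma row_unitary_neq0 n (V : 'M[R[i]]_n) i : V \is unitarymx -> row i V != 0.
Proof.
move=> Vu; apply/eqP => r0; have := sqnorm_row i Vu; rewrite r0 /sqnorm big1.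
  by move/eqP; rewrite eq_sym oner_eq0.
by move=> k _; rewrite mxE; apply/eqP; rewrite sqnormc_eq0.
Qed.

Lemma char_poly_conj (F : fieldType) n (P B : 'M[F]_n) : P \in unitmx ->
  char_poly (invmx P *m B *m P) = char_poly B.
Proof.
move=> Pu; have Pu' : map_mx polyC P \in unitmx by rewrite map_unitmx.
rewrite /char_poly /char_poly_mx !map_mxM/= map_invmx.
set Q := map_mx _ P in Pu' *; set C := map_mx _ B.
have QX : invmx Q *m 'X%:M *m Q = 'X%:M.
  by rewrite mul_mx_scalar -scalemxAl mulVmx// scalemx1.
rewrite -[X in X - _]QX -mulmxBl -mulmxBr !det_mulmx mulrAC -det_mulmx.
by rewrite mulVmx// det1 mul1r.
Qed.

(** Conjugate matrices have the same characteristic polynomial, and its multiset of roots determines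
    the sorted vector. *)
Lemma eigvals_decr_udiag n (V : 'M[R[i]]_n) (d : 'rV[R]_n) : V \is unitarymx ->
  eigvals_decr (udiag V d) = sort_decr d.
Proof.
move=> Vu; apply: sort_decr_eq.
have := char_poly_eigvals (udiag_hermsymm V d).
rewrite {1}/udiag -invmx_unitary// char_poly_conj ?unitarymx_unit//.
rewrite char_poly_trig ?diag_mx_is_trig//.
have cmap (e : 'rV[R]_n) : \prod_(j < n) ('X - ((e 0 j)%:C)%:P) =
    \prod_(z <- map (fun t => t%:C) [seq e 0 j | j <- enum 'I_n]) ('X - z%:P).
  by rewrite big_map big_map big_enum.
under eq_bigr do rewrite !mxE eqxx mulr1n.
rewrite !cmap => /prod_XsubC_eq; rewrite perm_sym.
by move=> /(perm_map (@complex.Re R)); rewrite -!map_comp.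
Qed.

End QuadraticForms.

(** * Unital positive maps *)

Section PositiveMaps.
Variables (R : realType) (m n : nat) (Phi : {linear 'M[R[i]]_m -> 'M[R[i]]_n}).
Hypotheses (Phi1 : unital_map Phi) (Phi_pos : positive_map Phi).

(* The weights are [mu_i = x Phi(P_i) x^*], with [P_i] the projection on the
   [i]-th row of [V]; only strict positivity of [Phi] is available, so
   [mu_i >= 0] is obtained by perturbing [P_i] into [P_i + eps I]. *)
Lemma positive_map_weights (V : 'M[R[i]]_m) (x : 'rV[R[i]]_n) :
  V \is unitarymx -> x != 0 ->
  exists mu : 'I_m -> R, [/\ forall j, 0 <= mu j, \sum_j mu j = sqnorm x &
    forall d, qform (Phi (udiag V d)) x = (\sum_j mu j * d 0 j)%:C].
Proof.
move=> Vu x0; pose F d := qform (Phi (udiag V d)) x.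
have FD d e : F (d + e) = F d + F e by rewrite /F udiagD linearD qformD.
have FZ c d : F (c *: d) = c%:C * F d by rewrite /F udiagZ linearZ qformZ.
have F1 : F (const_mx 1) = (sqnorm x)%:C.
  by rewrite /F (udiag_const _ Vu) (_ : Phi _ = 1%:M) ?qform1//; exact: Phi1.
have Fpos (d : 'rV[R]_m) : (forall j, 0 < d 0 j) -> 0 < F d.
  by move=> d0; apply: posdef_qform_gt0 => //; apply: Phi_pos; exact: udiag_posdef.
pose mu j := complex.Re (F (delta_mx 0 j)).
have Feps j (eps : R) : 0 < eps -> 0 < F (delta_mx 0 j) + (eps * sqnorm x)%:C.
  move=> eps0; rewrite rmorphM/= -F1 -FZ -FD; apply: Fpos => k.
  by rewrite !mxE mulr1 ltr_wpDl// ler0n.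
(* A number that becomes positive after adding a real number has zero imaginary part. *)
have muE j : F (delta_mx 0 j) = (mu j)%:C.
  have := Feps j 1 ltr01; rewrite /mu; case: (F _) => a b.
  by rewrite ltcE/= addr0 => /andP[/eqP ->].
have FE d : F d = (\sum_j mu j * d 0 j)%:C.
  have F0 : F 0 = 0 by rewrite -(scale0r 0) FZ mul0r.
  rewrite {1}[d]row_sum_delta (big_morph F FD F0) rmorph_sum/=.
  by apply: eq_bigr => j _; rewrite FZ muE mulrC rmorphM.
exists mu; split=> // [j|].
  have N0 := sqnorm_gt0 x0.
  apply/ler_addgt0Pr => eps eps0; have := Feps j (eps / sqnorm x) (divr_gt0 eps0 N0).
  by rewrite muE divfK ?gt_eqF// -rmorphD ltcR => /ltW.
apply: (@complexI R); rewrite -F1 FE.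
by congr (_%:C); apply: eq_bigr => j _; rewrite mxE mulr1.
Qed.

(** Adding a large multiple of the identity makes [A] positive definite, so the image of the sum is
    Hermitian; by unitality the same multiple can be subtracted after applying [Phi]. *)
Lemma positive_map_hermsymm (A : 'M[R[i]]_m) :
  A \is hermsymmx -> Phi A \is hermsymmx.
Proof.
move=> hA; have Vu := spectral_unitarymx A.
(* This [c] exceeds the absolute value of every eigenvalue. *)
pose c := 1 + \sum_j `|eigvals A 0 j|.
have [hAc _] : posdefmx (Phi (A + (c%:C)%:M)).
  apply: Phi_pos; rewrite {1}(hermsymm_udiagE hA) -(udiag_const c Vu) -udiagD.
  apply: udiag_posdef => // j; rewrite mxE [X in _ + X]mxE /c (bigD1 j)//=.
  have : 0 <= \sum_(k < m | k != j) `|eigvals A 0 k| by apply: sumr_ge0.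
  have := ler_norm (- eigvals A 0 j); rewrite normrN.
  set s := \sum_(k < m | _) _; set a := eigvals _ _ _; set b := `| a |.
  by move=> ? ?; lra.
have cE : (c%:C)%:M = c%:C *: (1%:M : 'M[R[i]]_m) by rewrite scalemx1.
have PhiE : Phi A = Phi (A + (c%:C)%:M) - (c%:C)%:M.
  rewrite linearD cE linearZ/=.
  have -> : Phi 1%:M = 1%:M by exact: Phi1.
  by rewrite scalemx1 addrK.
rewrite PhiE; apply: adjmx_hermsymm.
rewrite linearB/= map_mxB hermsymm_adjmx// tr_scalar_mx map_scalar_mx.
by congr (_ - _%:M); apply: (@conj_Creal R[i]); apply/complex_realP; exists c.
Qed.

End PositiveMaps.

(** * Eigenvectors and pairs of orthonormal bases *)

Lemma eigvals_in_spectrum (R : realType) n (A : 'M[R[i]]_n) j :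
  A \is hermsymmx -> spectrum A (eigvals A 0 j)%:C.
Proof.
move=> hA; have Pu := spectral_unitarymx A; apply/eigenvalueP.
exists (row j (spectralmx A)); last exact: row_unitary_neq0.
rewrite -row_mul {2}(hermsymm_udiagE hA) /udiag !mulmxA (unitarymxP Pu) mul1mx.
by apply/rowP => k; rewrite mxE mul_diag_mx !mxE.
Qed.

(** Exchanging the bases conjugates their inner products. Hence Parseval also gives the column sums
    of the overlap matrix, which is doubly stochastic for unitary [V] and [W]. *)
Lemma coord_weight_sym (R : realType) n (V W : 'M[R[i]]_n) i j :
  coord_weight W (row i V) j = coord_weight V (row j W) i.
Proof.
rewrite !coord_weight_row.
have -> : V *m W^t* = (W *m V^t*)^t* by rewrite trmx_mul map_mxM/= adjmxK.
rewrite !mxE; move: (\sum_ _ _) => z.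
by rewrite -[LHS]/(sqnormc z^*%C) /sqnormc; case: z => a b /=; rewrite sqrrN.
Qed.

(* The two spans have dimensions adding up to more than [n], so they meet. *)
Lemma common_support_vector (R : realType) n (V W : 'M[R[i]]_n)
    (S T : {set 'I_n}) : (n < #|S| + #|T|)%N ->
  exists x : 'rV[R[i]]_n, [/\ x != 0,
    forall j, j \notin S -> coord_weight V x j = 0 &
    forall j, j \notin T -> coord_weight W x j = 0].
Proof.
move=> nST.
(* The columns of [M] are the linear conditions on [x]: vanishing coordinates outside [S] along [V]
   and outside [T] along [W]. They number fewer than [n]. *)
pose M := row_mx (colsub (fun k : 'I_#|~: S| => enum_val k) (V^t*))
                 (colsub (fun k : 'I_#|~: T| => enum_val k) (W^t*)).
have /rowV0Pn[x /sub_kermxP xM x0] : kermx M != 0.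
  rewrite -mxrank_eq0 mxrank_ker subn_eq0 -ltnNge.
  suff : (#|~: S| + #|~: T| < n)%N by exact: leq_ltn_trans (rank_leq_col M).
  by have := cardsC S; have := cardsC T; rewrite card_ord; lia.
have colsub0 (U : 'M[R[i]]_n) (X : {set 'I_n}) :
    x *m colsub (fun k : 'I_#|~: X| => enum_val k) (U^t*) = 0 ->
    forall j, j \notin X -> coord_weight U x j = 0.
  move=> xU j jX; have jX' : j \in ~: X by rewrite inE.
  apply/eqP; rewrite sqnormc_eq0; apply/eqP.
  move/matrixP: xU => /(_ 0 (enum_rank_in jX' j)).
  rewrite !mxE => xU; apply: etrans xU; apply: eq_bigr => k _.
  by rewrite [in RHS]mxE enum_rankK_in.
move: xM; rewrite mul_mx_row -[0]row_mx0 => /eq_row_mx[xV xW].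
by exists x; split=> //; exact: colsub0.
Qed.

(** * Eigenvalue comparison from Jensen's inequality for quadratic forms *)

Section Comparison.
Variables (R : realType) (I : set R) (f : R -> R) (n : nat).
Variables (V W : 'M[R[i]]_n) (b e : 'rV[R]_n).
Hypotheses (I_itv : is_interval I) (Vu : V \is unitarymx) (Wu : W \is unitarymx).

Hypothesis jensen_qform : forall x : 'rV[R[i]]_n, x != 0 ->
  let p := \sum_j coord_weight V x j / sqnorm x * b 0 j in
  I p /\ f p <= \sum_j coord_weight W x j / sqnorm x * e 0 j.

(** For [x] the [j]-th row of [V], all the weight along [V] sits at [j], so [p] is [b 0 j]. *)
Lemma jensen_qform_row j :
  I (b 0 j) /\ f (b 0 j) <= \sum_k coord_weight W (row j V) k * e 0 k.
Proof.
have := jensen_qform (row_unitary_neq0 j Vu); rewrite (sqnorm_row j Vu) /=.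
have -> : \sum_k coord_weight V (row j V) k / 1 * b 0 k = b 0 j.
  rewrite (bigD1 j)//= coord_weight_unitary// eqxx divr1 mul1r big1 ?addr0// => k kj.
  by rewrite coord_weight_unitary// eq_sym (negbTE kj) mul0r mul0r.
by under eq_bigr do rewrite divr1.
Qed.

Lemma weak_majorized_jensen : weak_majorized (map_mx f b) e.
Proof.
apply: (@weak_majorized_doubly_stochastic _ _ _ _
  (\matrix_(i, j) coord_weight W (row i V) j)) => [i j|i|j|i].
- by rewrite mxE coord_weight_ge0.
- by under eq_bigr do rewrite mxE; rewrite sum_coord_weight// sqnorm_row.
- under eq_bigr do rewrite mxE coord_weight_sym.
  by rewrite sum_coord_weight// sqnorm_row.
- rewrite mxE; under eq_bigr do rewrite mxE.
  exact: (jensen_qform_row i).2.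
Qed.

Lemma sort_decr_le_jensen : monotone_on I f ->
  forall j, sort_decr (map_mx f b) 0 j <= sort_decr e 0 j.
Proof.
move=> mf; apply: sort_decr_le_count => c; rewrite leqNgt; apply/negP => card_lt.
set S := [set j | c <= (map_mx f b) 0 j] in card_lt.
set T := [set j | c <= e 0 j] in card_lt.
have nST : (n < #|S| + #|~: T|)%N by have := cardsC T; rewrite card_ord; lia.
have [x [x0 xS xT]] := common_support_vector V W nST.
have N0 := sqnorm_gt0 x0.
have wge0 (U : 'M[R[i]]_n) j : 0 <= coord_weight U x j / sqnorm x.
  by rewrite divr_ge0 ?coord_weight_ge0// ltW.
have wsum (U : 'M[R[i]]_n) : U \is unitarymx ->
    \sum_j coord_weight U x j / sqnorm x = 1.
  by move=> Uu; rewrite -mulr_suml sum_coord_weight// divff// gt_eqF.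
have [Ip fp] := jensen_qform x0.
(* All weights of [x] along [W] sit where [e] is below [c], and the half-line below [c] is
   convex. *)
have lt_c : \sum_j coord_weight W x j / sqnorm x * e 0 j < c.
  apply: (@convex_comb_closed R R^o (fun z => z < c) _ _ (fun j => e 0 j)) => //.
  - apply: (@is_interval_conv R (fun z => z < c)) => y z _ zc u /andP[_ uz].
    exact: le_lt_trans uz zc.
  - exact: wsum.
  - move=> j wj; rewrite ltNge; apply: contra wj => cj.
    by rewrite xT ?mul0r// inE negbK inE.
have := le_lt_trans fp lt_c; apply/negP; rewrite -leNgt.
(* All weights of [x] along [V] sit in [S], where [f] is at least [c]; so [f] is at least [c] at
   their average. *)
apply: (@monotone_superlevel R I) => // [|j wj]; first exact: wsum.
split; first exact: (jensen_qform_row j).1.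
apply: contraNT wj => /negbTE cj.
by rewrite xS ?mul0r// inE mxE cj.
Qed.

End Comparison.

(** * Jensen's inequality for unital positive maps *)

Section JensenForPositiveMaps.
Variables (R : realType) (I : set R) (f : R -> R) (m n : nat).
Variables (Phi : {linear 'M[R[i]]_m -> 'M[R[i]]_n}) (A : 'M[R[i]]_m).
Hypotheses (I_itv : is_interval I) (Phi1 : unital_map Phi).
Hypotheses (Phi_pos : positive_map Phi) (A_herm : A \is hermsymmx).
Hypothesis A_I : forall j, I (eigvals A 0 j).

(** The forms of [Phi A] and [Phi (herm_fun f A)] at [x] average the eigenvalues of [A] and their
    images under [f] with the same weights [mu]; dividing by [sqnorm x] makes these sum to 1. *)
Lemma positive_map_jensen (V W : 'M[R[i]]_n) (b e : 'rV[R]_n) :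
  convex_function (I : set R^o) f ->
  Phi A = udiag V b -> Phi (herm_fun f A) = udiag W e ->
  forall x : 'rV[R[i]]_n, x != 0 ->
  let p := \sum_j coord_weight V x j / sqnorm x * b 0 j in
  I p /\ f p <= \sum_j coord_weight W x j / sqnorm x * e 0 j.
Proof.
move=> cf PhiA PhifA x x0.
have [mu [mu0 mu1 muE]] := positive_map_weights Phi1 Phi_pos (spectral_unitarymx A) x0.
have N0 := sqnorm_gt0 x0.
have pE : \sum_j coord_weight V x j * b 0 j = \sum_j mu j * eigvals A 0 j.
  by apply: (@complexI R); rewrite -qform_udiag -PhiA {1}(hermsymm_udiagE A_herm) muE.
have qE : \sum_j coord_weight W x j * e 0 j = \sum_j mu j * f (eigvals A 0 j).
  apply: (@complexI R); rewrite -qform_udiag -PhifA herm_fun_udiag muE.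
  by congr (_%:C); apply: eq_bigr => j _; rewrite mxE.
have divE k (w v : 'I_k -> R) :
    \sum_j w j / sqnorm x * v j = (\sum_j w j * v j) / sqnorm x.
  by rewrite mulr_suml; apply: eq_bigr => j _; rewrite mulrAC.
rewrite /= !divE pE qE -!divE; apply: jensen => // [j|].
  by rewrite divr_ge0// ltW.
by rewrite -mulr_suml mu1 divff// gt_eqF.
Qed.

End JensenForPositiveMaps.

(** * Sign change for concave functions, and conclusion *)

Lemma herm_funN (R : realType) (f : R -> R) n (A : 'M[R[i]]_n) :
  herm_fun (fun t => - f t) A = - herm_fun f A.
Proof.
rewrite !herm_fun_udiag -udiagN; congr udiag.
by apply/rowP => j; rewrite !mxE.
Qed.

Lemma convex_functionN (R : realType) (I : set R) (f : R -> R) :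
  concave_function I f -> convex_function (I : set R^o) ((fun t => - f t) : R^o -> R^o).
Proof.
move=> cf t x y Ix Iy; have := cf t x y Ix Iy.
by rewrite -lerN2 convN.
Qed.

Lemma monotone_onN (R : realType) (I : set R) (f : R -> R) :
  monotone_on I f -> monotone_on I (fun t => - f t).
Proof.
by case=> mf; [right|left] => x y Ix Iy xy; rewrite lerN2; exact: mf.
Qed.

Local Open Scope classical_set_scope.
Local Open Scope ring_scope.
Local Open Scope complex_scope.

Theorem theorem2p4 (R : realType) (I : set R) (f : R -> R) (m n : nat)
    (Phi : {linear 'M[R[i]]_m -> 'M[R[i]]_n}) (A : 'M[R[i]]_m) :
  is_interval I ->
  unital_map Phi ->
  positive_map Phi ->
  A \is hermsymmx ->
  spectrum A `<=` [set x%:C | x in I] ->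
  ((convex_function (I : set R^o) f ->
      weak_majorized (eigvals_decr (herm_fun f (Phi A)))
                     (eigvals_decr (Phi (herm_fun f A)))) /\
   (concave_function I f ->
      weak_supermajorized (eigvals_decr (herm_fun f (Phi A)))
                          (eigvals_decr (Phi (herm_fun f A))))) /\
  ((convex_function (I : set R^o) f -> monotone_on I f ->
      forall j : 'I_n, eigvals_decr (herm_fun f (Phi A)) 0 j <=
                       eigvals_decr (Phi (herm_fun f A)) 0 j) /\
   (concave_function I f -> monotone_on I f ->
      forall j : 'I_n, eigvals_decr (herm_fun f (Phi A)) 0 j >=
                       eigvals_decr (Phi (herm_fun f A)) 0 j)).
Proof.
move=> I_itv Phi1 Phi_pos hA specA.
have A_I j : I (eigvals A 0 j).
  by have [x Ix /complexI <-] := specA _ (eigvals_in_spectrum j hA).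
have PhiA := hermsymm_udiagE (positive_map_hermsymm Phi1 Phi_pos hA).
have hfA : herm_fun f A \is hermsymmx by rewrite herm_fun_udiag udiag_hermsymm.
have PhifA := hermsymm_udiagE (positive_map_hermsymm Phi1 Phi_pos hfA).
have Vu := spectral_unitarymx (Phi A).
have Wu := spectral_unitarymx (Phi (herm_fun f A)).
set V := spectralmx _ in PhiA Vu; set b := eigvals _ in PhiA.
set W := spectralmx _ in PhifA Wu; set e := eigvals _ in PhifA.
have -> : eigvals_decr (herm_fun f (Phi A)) = sort_decr (map_mx f b).
  by rewrite herm_fun_udiag (eigvals_decr_udiag _ Vu).
have -> : eigvals_decr (Phi (herm_fun f A)) = sort_decr e by [].
(* Replacing [f] by its negative keeps the basis [W] and negates [e], so the concave cases reuse
   both bases. *)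
have PhifNA : Phi (herm_fun (fun t => - f t) A) = udiag W (- e).
  by rewrite herm_funN linearN PhifA udiagN.
have jensenP (cf : convex_function (I : set R^o) f) :=
  positive_map_jensen I_itv Phi1 Phi_pos hA A_I cf PhiA PhifA.
have jensenN (cf : concave_function I f) :=
  positive_map_jensen I_itv Phi1 Phi_pos hA A_I (convex_functionN cf) PhiA PhifNA.
have mapN : map_mx (fun t => - f t) b = - map_mx f b.
  by apply/rowP => j; rewrite !mxE.
split; split=> cf.
- apply/weak_majorized_sort_decr.
  exact: (weak_majorized_jensen Vu Wu (jensenP cf)).
- apply: weak_supermajorizedN; rewrite -mapN.
  exact: (weak_majorized_jensen Vu Wu (jensenN cf)).
- by move=> mf; exact: (sort_decr_le_jensen I_itv Vu Wu (jensenP cf) mf).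
- move=> mf; apply: sort_decr_leN; rewrite -mapN.
  exact: (sort_decr_le_jensen I_itv Vu Wu (jensenN cf) (monotone_onN mf)).
Qed.
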